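(* The model-checking problem for QCTL*_i under tree semantics is undecidable.
   Context: QCTL*_i extends CTL* with second-order quantifiers ∃^o p.φ over atomic propositions, annotated with a concrete observation o ⊆ [n]. Models are compound Kripke structures (CKS), whose states are tuples of local states in ∏_{i∈[n]} L_i (the L_i disjoint finite sets). Under tree semantics formulas are evaluated on the tree unfolding of the CKS from its initial state; ∃^o p.φ holds in a labelled tree t if there is a tree t' equal to t except possibly for the labelling of p, such that t' is o-uniform in p (any two nodes of the same depth whose states agree pointwise on the components indexed by o agree on p) and t' satisfies φ. The model-checking problem: given a CKS K and a QCTL*_i formula φ, decide whether the unfolding of K satisfies φ. *)

(* Defs.v *)
From Stdlib Require Import List Arith.
Import ListNotations.

(* A state is a tuple (list) of n local states; the i-th component is *)
(* a local state of L_i (identified by its position i, so the L_i are *)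
(* disjoint by construction).  Atomic propositions are naturals.      *)

Definition state := list nat.

Record CKS := mkCKS {
  cks_n : nat;
  cks_states : list state;
  cks_init : state;
  cks_trans : list (state * state);
  cks_lab : list (state * list nat)
}.

Definition cks_label (K : CKS) (s : state) (p : nat) : Prop :=
  exists ps, In (s, ps) (cks_lab K) /\ In p ps.

Definition wf_CKS (K : CKS) : Prop :=
  (forall s, In s (cks_states K) -> length s = cks_n K) /\
  In (cks_init K) (cks_states K) /\
  (forall s s', In (s, s') (cks_trans K) ->
      In s (cks_states K) /\ In s' (cks_states K)) /\
  (forall s, In s (cks_states K) -> exists s', In (s, s') (cks_trans K)) /\
  (forall s ps, In (s, ps) (cks_lab K) -> In s (cks_states K)).

(* QCTL*_i syntax.  Observations o are finite subsets of [n] = {0..n-1}*)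
(* given as lists of component indices.                               *)

Inductive sform : Type :=
| SAP  (p : nat)
| SNot (f : sform)
| SOr  (f g : sform)
| SE   (psi : pform)
| SEx  (o : list nat) (p : nat) (f : sform)
with pform : Type :=
| PS   (f : sform)
| PNot (psi : pform)
| POr  (psi1 psi2 : pform)
| PX   (psi : pform)
| PU   (psi1 psi2 : pform).

Fixpoint obs_ok_s (n : nat) (f : sform) : Prop :=
  match f with
  | SAP _ => True
  | SNot g => obs_ok_s n g
  | SOr g h => obs_ok_s n g /\ obs_ok_s n h
  | SE psi => obs_ok_p n psi
  | SEx o _ g => (forall i, In i o -> i < n) /\ obs_ok_s n g
  end
with obs_ok_p (n : nat) (psi : pform) : Prop :=
  match psi with
  | PS g => obs_ok_s n g
  | PNot a => obs_ok_p n a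
  | POr a b => obs_ok_p n a /\ obs_ok_p n b
  | PX a => obs_ok_p n a
  | PU a b => obs_ok_p n a /\ obs_ok_p n b
  end.

Definition node := list state.

Definition child (K : CKS) (u v : node) : Prop :=
  exists s, v = u ++ [s] /\ In (last u (cks_init K), s) (cks_trans K).

Inductive is_node (K : CKS) : node -> Prop :=
| node_root : is_node K [cks_init K]
| node_child : forall u v, is_node K u -> child K u v -> is_node K v.

Definition is_path (K : CKS) (pi : nat -> node) : Prop :=
  forall k, child K (pi k) (pi (S k)).

Definition suffix (pi : nat -> node) (k : nat) : nat -> node :=
  fun j => pi (k + j).

Definition labelling := node -> nat -> Prop.

Definition unfold_lab (K : CKS) : labelling :=
  fun u p => cks_label K (last u (cks_init K)) p.

Definition obs_eq (o : list nat) (u v : node) : Prop :=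
  Forall2 (fun s s' => forall i, In i o -> nth i s 0 = nth i s' 0) u v.

Definition uniform (K : CKS) (o : list nat) (p : nat) (lam : labelling) : Prop :=
  forall u v, is_node K u -> is_node K v -> obs_eq o u v ->
    (lam u p <-> lam v p).

Fixpoint sat_s (K : CKS) (lam : labelling) (f : sform) (u : node) {struct f} : Prop :=
  match f with
  | SAP p => lam u p
  | SNot g => ~ sat_s K lam g u
  | SOr g h => sat_s K lam g u \/ sat_s K lam h u
  | SE psi => exists pi, is_path K pi /\ pi 0 = u /\ sat_p K lam psi pi
  | SEx o p g =>
      exists lam' : labelling,
        (forall v q, q <> p -> (lam' v q <-> lam v q)) /\
        uniform K o p lam' /\
        sat_s K lam' g u
  end
with sat_p (K : CKS) (lam : labelling) (psi : pform) (pi : nat -> node) {struct psi} : Prop :=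
  match psi with
  | PS g => sat_s K lam g (pi 0)
  | PNot a => ~ sat_p K lam a pi
  | POr a b => sat_p K lam a pi \/ sat_p K lam b pi
  | PX a => sat_p K lam a (suffix pi 1)
  | PU a b => exists k, sat_p K lam b (suffix pi k) /\
                        forall j, j < k -> sat_p K lam a (suffix pi j)
  end.

Definition model_check (K : CKS) (f : sform) : Prop :=
  sat_s K (unfold_lab K) f [cks_init K].

(* Encoding of instances as natural numbers (Cantor pairing).         *)

Definition cpair (a b : nat) : nat := (a + b) * S (a + b) / 2 + b.

Fixpoint enc_list {A} (f : A -> nat) (l : list A) : nat :=
  match l with
  | [] => 0
  | x :: l' => S (cpair (f x) (enc_list f l'))
  end.

Definition enc_state (s : state) : nat := enc_list (fun x => x) s.

Definition enc_CKS (K : CKS) : nat :=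
  cpair (cks_n K)
   (cpair (enc_list enc_state (cks_states K))
    (cpair (enc_state (cks_init K))
     (cpair (enc_list (fun e => cpair (enc_state (fst e)) (enc_state (snd e))) (cks_trans K))
            (enc_list (fun e => cpair (enc_state (fst e)) (enc_list (fun x => x) (snd e)))
                      (cks_lab K))))).

Fixpoint enc_s (f : sform) : nat :=
  match f with
  | SAP p => cpair 0 p
  | SNot g => cpair 1 (enc_s g)
  | SOr g h => cpair 2 (cpair (enc_s g) (enc_s h))
  | SE psi => cpair 3 (enc_p psi)
  | SEx o p g => cpair 4 (cpair (enc_list (fun x => x) o) (cpair p (enc_s g)))
  end
with enc_p (psi : pform) : nat :=
  match psi with
  | PS g => cpair 0 (enc_s g)
  | PNot a => cpair 1 (enc_p a)
  | POr a b => cpair 2 (cpair (enc_p a) (enc_p b))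
  | PX a => cpair 3 (enc_p a)
  | PU a b => cpair 4 (cpair (enc_p a) (enc_p b))
  end.

Definition enc_instance (K : CKS) (f : sform) : nat := cpair (enc_CKS K) (enc_s f).

(* Model of computation: Minsky (counter) machines, Turing complete.  *)

Inductive instr : Type :=
| INC (r : nat)
| DEC (r : nat) (j : nat).

Definition program := list instr.

Definition config := (nat * (nat -> nat))%type.

Definition upd (g : nat -> nat) (r v : nat) : nat -> nat :=
  fun x => if Nat.eqb x r then v else g x.

Definition step (P : program) (c : config) : config :=
  let '(pc, g) := c in
  match nth_error P pc with
  | None => c
  | Some (INC r) => (S pc, upd g r (S (g r)))
  | Some (DEC r j) =>
      if Nat.eqb (g r) 0 then (j, g) else (S pc, upd g r (pred (g r)))
  end.

Fixpoint run (P : program) (k : nat) (c : config) : config :=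
  match k with
  | 0 => c
  | S k' => run P k' (step P c)
  end.

Definition halted (P : program) (c : config) : Prop := nth_error P (fst c) = None.

Definition init_config (x : nat) : config := (0, fun r => if Nat.eqb r 0 then x else 0).

Definition MM_answers (P : program) (x : nat) (b : Prop) : Prop :=
  exists k, halted P (run P k (init_config x)) /\
    ((b /\ snd (run P k (init_config x)) 1 = 1) \/
     (~ b /\ snd (run P k (init_config x)) 1 = 0)).

Definition wf_instance (K : CKS) (f : sform) : Prop :=
  wf_CKS K /\ obs_ok_s (cks_n K) f.

(* Main.v *)
Require Import Defs.
From Stdlib Require Import List Arith Lia.
From Stdlib Require Import Classical FunctionalExtensionality PropExtensionality.
Import ListNotations.

(* In the unfolding of the structure a -> a, a -> b, b -> b the nodes a^(i+1) b^j
   form a quarter plane whose i-th row (the branch leaving the spine after a^(i+1))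
   can store the configuration of a counter machine at time i: an existentially
   quantified proposition with full observation marks, for each register, the cell
   whose index is its content.  A universally quantified proposition with empty
   observation is a set of levels, so it can be used to require that the marks of two
   consecutive rows lie on prescribed relative levels; this expresses one machine step.
   Hence some formula holds iff a given machine does not halt on a given input x, and x
   enters the formula only through a block X^x.  If [c] is the code of the
   machine-dependent subformula, the code of the whole instance with x = [c] is therefore
   computed from [c] by iterated Cantor pairing, a loop program.  Running this program,
   then the alleged decider, and halting iff the answer is 1 (does not halt), gives a
   machine that contradicts itself on the code of its own subformula. *)

(** * Counter machines *)

Lemma run_add M j k c : run M (j + k) c = run M k (run M j c).
Proof. revert c; induction j; intros c; simpl; auto. Qed.

Lemma run_succ M k c : run M (S k) c = step M (run M k c).
Proof. replace (S k) with (k + 1) by lia. apply run_add. Qed.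

Lemma step_halted M c : halted M c -> step M c = c.
Proof. destruct c as [pc g]; unfold halted; simpl; now intros ->. Qed.

Lemma run_fixed M k c : step M c = c -> run M k c = c.
Proof. intros H; induction k; simpl; [|rewrite H]; auto. Qed.

Definition halts (M : program) (x : nat) : Prop :=
  exists k, halted M (run M k (init_config x)).

Lemma loop_not_halts M x k c :
  run M k (init_config x) = c -> step M c = c -> ~ halted M c -> ~ halts M x.
Proof.
  intros Hk Hc Hn [j Hj]. apply Hn.
  assert (E : run M (j + k) (init_config x) = c).
  { rewrite Nat.add_comm, run_add, Hk. now apply run_fixed. }
  rewrite run_add, run_fixed in E by now apply step_halted.
  now rewrite <- E.
Qed.

Definition reach (M : program) (c c' : config) : Prop := exists k, run M k c = c'.

Lemma reach_refl M c : reach M c c.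
Proof. now exists 0. Qed.

Lemma reach_trans M c1 c2 c3 : reach M c1 c2 -> reach M c2 c3 -> reach M c1 c3.
Proof. intros [j <-] [k <-]. exists (j + k). apply run_add. Qed.

Lemma reach_step M c1 c2 c3 : step M c1 = c2 -> reach M c2 c3 -> reach M c1 c3.
Proof. intros <- [k <-]. now exists (S k). Qed.

Definition code_at (M : program) (base : nat) (Q : program) : Prop :=
  forall k i, nth_error Q k = Some i -> nth_error M (base + k) = Some i.

Lemma code_at_app M base Q1 Q2 :
  code_at M base (Q1 ++ Q2) ->
  code_at M base Q1 /\ code_at M (base + length Q1) Q2.
Proof.
  intros H; split; intros k i Hk.
  - apply H. rewrite nth_error_app1; auto. apply nth_error_Some. congruence.
  - rewrite <- Nat.add_assoc. apply H. rewrite nth_error_app2 by lia.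
    replace (length Q1 + k - length Q1) with k by lia. auto.
Qed.

Lemma code_at_mid Q1 Q2 Q3 : code_at (Q1 ++ Q2 ++ Q3) (length Q1) Q2.
Proof.
  intros k i Hk. rewrite nth_error_app2 by lia.
  replace (length Q1 + k - length Q1) with k by lia.
  rewrite nth_error_app1; auto. apply nth_error_Some. congruence.
Qed.

(** All jumps out of the program are redirected to the address just past it, so the relocated code
    has a single exit, whatever address the original halts at. *)
Definition relocate_instr (base n : nat) (i : instr) : instr :=
  match i with
  | INC r => INC r
  | DEC r j => DEC r (base + min j n)
  end.

Definition relocate (base : nat) (P : program) : program :=
  map (relocate_instr base (length P)) P.

Lemma relocate_run M base P k c :
  code_at M base (relocate base P) ->
  reach M (base + min (fst c) (length P), snd c)
          (base + min (fst (run P k c)) (length P), snd (run P k c)).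
Proof.
  intros HM. revert c; induction k as [|k IH]; intros [pc g]; [apply reach_refl|].
  change (run P (S k) (pc, g)) with (run P k (step P (pc, g))).
  eapply reach_trans; [|apply IH].
  unfold step at 1 2. destruct (nth_error P pc) as [i|] eqn:E; [|apply reach_refl].
  assert (L : pc < length P) by (apply nth_error_Some; congruence).
  assert (H : nth_error M (base + pc) = Some (relocate_instr base (length P) i)).
  { apply HM. unfold relocate. now rewrite nth_error_map, E. }
  eapply reach_step; [|apply reach_refl].
  cbn [fst snd]. replace (min pc (length P)) with pc by lia.
  unfold step. rewrite H. destruct i as [r|r j]; cbn [relocate_instr].
  - cbn [fst snd]. f_equal. lia.
  - destruct (g r =? 0); cbn [fst snd]; f_equal; lia.
Qed.

(** * Loop programs and their compilation *)

Inductive com : Type :=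
| Skip
| Inc (r : nat)
| Seq (a b : com)
| For (r : nat) (b : com).

Fixpoint set_nth (r v : nat) (l : list nat) : list nat :=
  match r, l with
  | _, [] => []
  | 0, _ :: l' => v :: l'
  | S r', x :: l' => x :: set_nth r' v l'
  end.

(** Derivations exist only for terminating runs, so [For], which re-reads [r] after each body and is
    really a while loop, needs no termination argument. *)
Inductive exec : com -> list nat -> list nat -> Prop :=
| exec_skip l : exec Skip l l
| exec_inc r l : r < length l -> exec (Inc r) l (set_nth r (S (nth r l 0)) l)
| exec_seq a b l1 l2 l3 : exec a l1 l2 -> exec b l2 l3 -> exec (Seq a b) l1 l3
| exec_for_zero r b l : nth r l 0 = 0 -> exec (For r b) l l
| exec_for_succ r b n l1 l2 l3 :
    nth r l1 0 = S n -> exec b (set_nth r n l1) l2 -> exec (For r b) l2 l3 ->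
    exec (For r b) l1 l3.

Fixpoint size (c : com) : nat :=
  match c with
  | Skip => 0
  | Inc _ => 1
  | Seq a b => size a + size b
  | For _ b => 2 + size b
  end.

(* Register [z] must hold 0, which turns [DEC z] into an unconditional jump. *)
Fixpoint compile (z base : nat) (c : com) : program :=
  match c with
  | Skip => []
  | Inc r => [INC r]
  | Seq a b => compile z base a ++ compile z (base + size a) b
  | For r b => DEC r (base + (2 + size b)) :: compile z (S base) b ++ [DEC z base]
  end.

Lemma length_compile z base c : length (compile z base c) = size c.
Proof.
  revert base; induction c; intros base; simpl; auto; rewrite length_app.
  - now rewrite IHc1, IHc2.
  - rewrite IHc; simpl; lia.
Qed.

Lemma length_set_nth r v l : length (set_nth r v l) = length l.
Proof. revert l; induction r; intros [|x l]; simpl; auto. Qed.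

Lemma length_exec c l l' : exec c l l' -> length l' = length l.
Proof.
  induction 1; rewrite ?length_set_nth in *; congruence.
Qed.

Definition store (l : list nat) : nat -> nat := fun r => nth r l 0.

Lemma store_set_nth l r v : r < length l -> upd (store l) r v = store (set_nth r v l).
Proof.
  intros H. apply functional_extensionality; intros x. unfold upd, store.
  revert r x H; induction l as [|y l IH]; intros r x H; simpl in H; [lia|].
  destruct r, x; simpl; auto. apply IH; lia.
Qed.

(** With [z = length l] the jump register lies just outside the file, where [store] returns the
    default 0. [exec] preserves the length, so this persists through loops. *)
Lemma compile_correct M z c l l' :
  exec c l l' -> forall base, length l = z -> code_at M base (compile z base c) ->
  reach M (base, store l) (base + size c, store l').
Proof.
  induction 1 as [l|r l Hr|a b l1 l2 l3 Ha IHa Hb IHb|r b l Hr|r b n l1 l2 l3 Hr Hb IHb Hf IHf];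
    intros base Hz HM; simpl in *.
  - rewrite Nat.add_0_r. apply reach_refl.
  - assert (E := HM 0 _ eq_refl). rewrite Nat.add_0_r in E.
    eapply reach_step; [|apply reach_refl]. simpl. rewrite E.
    rewrite store_set_nth by auto. f_equal; lia.
  - apply code_at_app in HM as [H1 H2]. rewrite length_compile in H2.
    eapply reach_trans; [apply IHa; auto|].
    rewrite Nat.add_assoc. apply IHb; auto.
    now rewrite (length_exec _ _ _ Ha).
  - assert (E := HM 0 _ eq_refl). rewrite Nat.add_0_r in E.
    eapply reach_step; [|apply reach_refl]. simpl. rewrite E.
    change (store l r) with (nth r l 0). now rewrite Hr.
  - assert (E := HM 0 _ eq_refl). rewrite Nat.add_0_r in E.
    assert (HM' : code_at M (S base) (compile z (S base) b ++ [DEC z base])).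
    { intros k i Hk. replace (S base + k) with (base + S k) by lia. now apply HM. }
    apply code_at_app in HM' as [Hbody Hjump]. rewrite length_compile in Hjump.
    (* A nonzero value cannot be the default of [nth]. *)
    assert (Hlr : r < length l1).
    { destruct (Nat.lt_ge_cases r (length l1)); auto. rewrite nth_overflow in Hr by auto. lia. }
    assert (Hl2 : length l2 = z) by (rewrite (length_exec _ _ _ Hb), length_set_nth; auto).
    apply (reach_trans _ _ (S base + size b, store l2)).
    + eapply reach_step; [|apply IHb; [rewrite length_set_nth|]; eauto].
      simpl. rewrite E. change (store l1 r) with (nth r l1 0). rewrite Hr. simpl.
      now rewrite store_set_nth.
    + assert (E' := Hjump 0 _ eq_refl). rewrite Nat.add_0_r in E'.
      eapply reach_step; [|apply IHf; auto].
      unfold step. rewrite E'. unfold store at 1. rewrite nth_overflow by lia. reflexivity.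
Qed.

(** * Cantor pairing by a loop program *)

Fixpoint tri (n : nat) : nat :=
  match n with 0 => 0 | S m => S m + tri m end.

Lemma cpair_tri a b : cpair a b = tri (a + b) + b.
Proof.
  unfold cpair. f_equal. generalize (a + b). intros n.
  assert (E : n * S n = tri n * 2) by (induction n; simpl in *; lia).
  now rewrite E, Nat.div_mul.
Qed.

Fixpoint inc_times (k r : nat) : com :=
  match k with 0 => Skip | S k' => Seq (Inc r) (inc_times k' r) end.

(* Replaces register 0 by [cpair] of registers 1 and 0; registers 2-5 are scratch. *)
Definition pair_com : com :=
  Seq (For 0 (Seq (Inc 2) (Inc 3)))
  (Seq (For 1 (Inc 2))
  (Seq (For 2 (Seq (Inc 4) (Seq (For 4 (Seq (Inc 3) (Inc 5))) (For 5 (Inc 4)))))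
  (Seq (For 4 Skip) (For 3 (Inc 0))))).

Ltac exec_step :=
  match goal with
  | |- exec (Seq _ _) _ _ => eapply exec_seq
  | |- exec (Inc _) _ _ => apply exec_inc; simpl; lia
  | |- exec Skip _ _ => apply exec_skip
  end.

Lemma pair_com_correct x z y w :
  exec pair_com [z; x; 0; 0; 0; 0; y; w] [cpair x z; 0; 0; 0; 0; 0; y; w].
Proof.
  assert (H1 : forall z x n m, exec (For 0 (Seq (Inc 2) (Inc 3)))
      [z; x; n; m; 0; 0; y; w] [0; x; z + n; z + m; 0; 0; y; w]).
  { induction z0 as [|z0 IH]; intros; [now apply exec_for_zero|].
    eapply exec_for_succ; [reflexivity|repeat exec_step|].
    simpl. replace (S (z0 + n)) with (z0 + S n) by lia.
    replace (S (z0 + m)) with (z0 + S m) by lia. apply IH. }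
  assert (H2 : forall x n m, exec (For 1 (Inc 2))
      [0; x; n; m; 0; 0; y; w] [0; 0; x + n; m; 0; 0; y; w]).
  { induction x0 as [|x0 IH]; intros; [now apply exec_for_zero|].
    eapply exec_for_succ; [reflexivity|repeat exec_step|].
    simpl. replace (S (x0 + n)) with (x0 + S n) by lia. apply IH. }
  assert (H3 : forall i n m t, exec (For 4 (Seq (Inc 3) (Inc 5)))
      [0; 0; n; m; i; t; y; w] [0; 0; n; i + m; 0; i + t; y; w]).
  { induction i as [|i IH]; intros; [now apply exec_for_zero|].
    eapply exec_for_succ; [reflexivity|repeat exec_step|].
    simpl. replace (S (i + m)) with (i + S m) by lia.
    replace (S (i + t)) with (i + S t) by lia. apply IH. }
  assert (H4 : forall t n m i, exec (For 5 (Inc 4))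
      [0; 0; n; m; i; t; y; w] [0; 0; n; m; t + i; 0; y; w]).
  { induction t as [|t IH]; intros; [now apply exec_for_zero|].
    eapply exec_for_succ; [reflexivity|repeat exec_step|].
    simpl. replace (S (t + i)) with (t + S i) by lia. apply IH. }
  (* Each round raises register 4 from [i] to [S i] and adds [S i] to register 3, register 5 serving
     to restore register 4; this turns [tri i] into [tri (S i)]. *)
  assert (H5 : forall n m i, exec
      (For 2 (Seq (Inc 4) (Seq (For 4 (Seq (Inc 3) (Inc 5))) (For 5 (Inc 4)))))
      [0; 0; n; tri i + m; i; 0; y; w] [0; 0; 0; tri (n + i) + m; n + i; 0; y; w]).
  { induction n as [|n IH]; intros; [now apply exec_for_zero|].
    eapply exec_for_succ; [reflexivity| |].
    - eapply exec_seq; [exec_step|]. eapply exec_seq; [apply H3|apply H4].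
    - replace (S n + i) with (n + S i) by lia.
      replace (S i + 0 + 0) with (S i) by lia.
      simpl. rewrite !Nat.add_0_r, Nat.add_assoc. apply (IH m (S i)). }
  assert (H6 : forall i m, exec (For 4 Skip)
      [0; 0; 0; m; i; 0; y; w] [0; 0; 0; m; 0; 0; y; w]).
  { induction i as [|i IH]; intros; [now apply exec_for_zero|].
    eapply exec_for_succ; [reflexivity|repeat exec_step|apply IH]. }
  assert (H7 : forall m s, exec (For 3 (Inc 0))
      [s; 0; 0; m; 0; 0; y; w] [m + s; 0; 0; 0; 0; 0; y; w]).
  { induction m as [|m IH]; intros; [now apply exec_for_zero|].
    eapply exec_for_succ; [reflexivity|repeat exec_step|].
    simpl. replace (S (m + s)) with (m + S s) by lia. apply IH. }
  rewrite cpair_tri. unfold pair_com.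
  eapply exec_seq; [apply H1|]. eapply exec_seq; [apply H2|].
  eapply exec_seq; [apply (H5 _ (z + 0) 0)|].
  eapply exec_seq; [apply H6|].
  replace (tri (x + z) + z) with (tri (x + (z + 0) + 0) + (z + 0) + 0)
    by (rewrite !Nat.add_0_r; reflexivity).
  apply H7.
Qed.

Lemma inc_times_correct k r l :
  r < length l -> exec (inc_times k r) l (set_nth r (k + nth r l 0) l).
Proof.
  revert l; induction k as [|k IH]; intros l Hr; simpl.
  - replace (set_nth r (nth r l 0) l) with l; [apply exec_skip|].
    clear. revert l; induction r; intros [|x l]; simpl; auto. now rewrite <- IHr.
  - eapply exec_seq; [now apply exec_inc|].
    replace (set_nth r (S (k + nth r l 0)) l) with
      (set_nth r (k + nth r (set_nth r (S (nth r l 0)) l) 0) (set_nth r (S (nth r l 0)) l)).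
    + apply IH. now rewrite length_set_nth.
    + clear IH. revert l Hr; induction r; intros [|x l] Hr; simpl in *; try lia.
      * f_equal; lia.
      * f_equal. apply IHr; lia.
Qed.

(** * Computing the diagonal instance *)

Definition pair_const (k : nat) : com := Seq (inc_times k 1) pair_com.

Lemma pair_const_correct k z y w :
  exec (pair_const k) [z; 0; 0; 0; 0; 0; y; w] [cpair k z; 0; 0; 0; 0; 0; y; w].
Proof.
  eapply exec_seq; [apply inc_times_correct; simpl; lia|].
  simpl. rewrite Nat.add_0_r. apply pair_com_correct.
Qed.

Fixpoint pair_consts (ks : list nat) : com :=
  match ks with [] => Skip | k :: ks' => Seq (pair_consts ks') (pair_const k) end.

Lemma pair_consts_correct ks z y w :
  exec (pair_consts ks) [z; 0; 0; 0; 0; 0; y; w]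
       [fold_right cpair z ks; 0; 0; 0; 0; 0; y; w].
Proof.
  induction ks as [|k ks IH]; simpl; [apply exec_skip|].
  eapply exec_seq; [apply IH|apply pair_const_correct].
Qed.

(** The input is duplicated because it has two uses: register 7 counts the repetitions of the tag
    [k] above the seed [s], and register 6 keeps the input to become the first component of the
    central pair. *)
Definition diagonal_com (s k : nat) (inner outer : list nat) : com :=
  Seq (For 0 (Seq (Inc 6) (Inc 7)))
  (Seq (inc_times s 0)
  (Seq (For 7 (pair_const k))
  (Seq (pair_consts inner)
  (Seq (For 6 (Inc 1))
  (Seq pair_com (pair_consts outer)))))).

Lemma diagonal_com_correct s k inner outer x :
  exec (diagonal_com s k inner outer) [x; 0; 0; 0; 0; 0; 0; 0]
    [fold_right cpair (cpair x (fold_right cpair (Nat.iter x (cpair k) s) inner)) outer;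
     0; 0; 0; 0; 0; 0; 0].
Proof.
  assert (H1 : forall x y w, exec (For 0 (Seq (Inc 6) (Inc 7)))
      [x; 0; 0; 0; 0; 0; y; w] [0; 0; 0; 0; 0; 0; x + y; x + w]).
  { induction x0 as [|x0 IH]; intros; [now apply exec_for_zero|].
    eapply exec_for_succ; [reflexivity|repeat exec_step|].
    simpl. replace (S (x0 + y)) with (x0 + S y) by lia.
    replace (S (x0 + w)) with (x0 + S w) by lia. apply IH. }
  assert (H2 : forall w z y, exec (For 7 (pair_const k))
      [z; 0; 0; 0; 0; 0; y; w] [Nat.iter w (cpair k) z; 0; 0; 0; 0; 0; y; 0]).
  { induction w as [|w IH]; intros; [now apply exec_for_zero|].
    eapply exec_for_succ; [reflexivity|apply pair_const_correct|].
    rewrite Nat.iter_succ_r. apply IH. }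
  assert (H3 : forall y z u, exec (For 6 (Inc 1))
      [z; u; 0; 0; 0; 0; y; 0] [z; y + u; 0; 0; 0; 0; 0; 0]).
  { induction y as [|y IH]; intros; [now apply exec_for_zero|].
    eapply exec_for_succ; [reflexivity|repeat exec_step|].
    simpl. replace (S (y + u)) with (y + S u) by lia. apply IH. }
  eapply exec_seq; [apply H1|].
  eapply exec_seq; [apply inc_times_correct; simpl; lia|].
  simpl. rewrite !Nat.add_0_r.
  eapply exec_seq; [apply H2|].
  eapply exec_seq; [apply pair_consts_correct|].
  eapply exec_seq; [apply H3|]. rewrite Nat.add_0_r.
  eapply exec_seq; [apply pair_com_correct|apply pair_consts_correct].
Qed.

(* The final [DEC] is a self-loop exactly when [P] answers 0. *)
Definition diagonal_machine (P : program) (c : com) : program :=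
  let pre := compile 8 0 c in
  pre ++ relocate (length pre) P ++ [DEC 1 (length pre + length P)].

Lemma diagonal_machine_halts P c x y b :
  exec c [x; 0; 0; 0; 0; 0; 0; 0] [y; 0; 0; 0; 0; 0; 0; 0] ->
  MM_answers P y b ->
  (halts (diagonal_machine P c) x <-> b).
Proof.
  intros Hc [k [Hh Hb]].
  set (D := diagonal_machine P c). set (pre := compile 8 0 c).
  (* All scratch registers are back at 0, so [P] starts from a genuine initial configuration. *)
  assert (S0 : forall n, store [n; 0; 0; 0; 0; 0; 0; 0] = snd (init_config n)).
  { intros n. apply functional_extensionality. intros [|r]; auto. unfold store.
    do 8 (destruct r as [|r]; auto). }
  assert (R1 : reach D (init_config x) (length pre, snd (init_config y))).
  { change (init_config x) with (0, snd (init_config x)). rewrite <- (S0 x), <- (S0 y).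
    unfold pre. rewrite length_compile, <- (Nat.add_0_l (size c)).
    apply compile_correct with (z := 8); auto.
    unfold D, diagonal_machine. intros j i Hj. simpl.
    rewrite nth_error_app1; auto. apply nth_error_Some. congruence. }
  assert (R2 : reach D (length pre, snd (init_config y))
                 (length pre + length P, snd (run P k (init_config y)))).
  { assert (H := relocate_run D (length pre) P k (init_config y) (code_at_mid _ _ _)).
    simpl in H. rewrite Nat.add_0_r in H.
    (* [P] has halted, so its truncated address is the common exit, where the final [DEC] sits. *)
    apply nth_error_None in Hh. rewrite Nat.min_r in H by auto. exact H. }
  destruct (reach_trans _ _ _ _ R1 R2) as [n Hn].
  assert (E : nth_error D (length pre + length P) = Some (DEC 1 (length pre + length P))).
  { unfold D, diagonal_machine. fold pre. rewrite app_assoc, nth_error_app2;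
      rewrite length_app; unfold relocate; rewrite length_map; auto.
    now rewrite Nat.sub_diag. }
  destruct Hb as [[Hb H1]|[Hb H0]]; split; try tauto; intros Hx.
  - exists (n + 1). rewrite run_add, Hn. cbn [run]. unfold step.
    rewrite E, H1. unfold halted. cbn [Nat.eqb fst]. apply nth_error_None.
    unfold D, diagonal_machine. fold pre.
    rewrite !length_app. unfold relocate; rewrite length_map. simpl; lia.
  - exfalso. revert Hx. apply (loop_not_halts _ _ _ _ Hn).
    + unfold step. now rewrite E, H0.
    + unfold halted. simpl. now rewrite E.
Qed.

(** * The grid *)

Definition grid : CKS :=
  mkCKS 1 [[0]; [1]] [0] [([0], [0]); ([0], [1]); ([1], [1])] [([0], [0])].

Lemma wf_grid : wf_CKS grid.
Proof.
  repeat split; simpl.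
  - intros s [<-|[<-|[]]]; reflexivity.
  - auto.
  - destruct H as [H|[H|[H|[]]]]; injection H; intros; subst; auto.
  - destruct H as [H|[H|[H|[]]]]; injection H; intros; subst; auto.
  - intros s [<-|[<-|[]]]; eauto.
  - intros s ps [H|[]]; injection H; auto.
Qed.

(** The level of a cell is [i + j]: moving up the spine and moving right both go one level deeper,
    so column [j] of row [S i] is level with column [S j] of row [i]. *)
Definition cell (i j : nat) : node := repeat [0] (S i) ++ repeat [1] j.

Lemma length_cell i j : length (cell i j) = S i + j.
Proof. unfold cell. now rewrite length_app, !repeat_length. Qed.

Lemma cell_up i : cell (S i) 0 = cell i 0 ++ [[0]].
Proof. unfold cell. simpl. rewrite !app_nil_r. f_equal. now rewrite <- repeat_cons. Qed.

Lemma cell_right i j : cell i (S j) = cell i j ++ [[1]].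
Proof. unfold cell. rewrite <- app_assoc. f_equal. simpl. apply repeat_cons. Qed.

Lemma last_cell i j : last (cell i j) [0] = match j with 0 => [0] | S _ => [1] end.
Proof.
  destruct j; [destruct i; [reflexivity|rewrite cell_up]|rewrite cell_right];
    apply last_last.
Qed.

Lemma cell_inj i j i' j' : cell i j = cell i' j' -> i = i' /\ j = j'.
Proof.
  unfold cell. revert i'; induction i as [|i IH]; intros [|i'] H.
  - apply (f_equal (@length _)) in H. rewrite !length_app, !repeat_length in H. lia.
  - destruct j; simpl in H; discriminate H.
  - destruct j'; simpl in H; discriminate H.
  - injection H; intros H'. destruct (IH i') as [-> ->]; auto.
    simpl. now f_equal.
Qed.

Lemma child_cell i j v :
  child grid (cell i j) v <-> v = cell i (S j) \/ (j = 0 /\ v = cell (S i) 0).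
Proof.
  unfold child. cbn [cks_init cks_trans grid]. rewrite last_cell. split.
  - intros [s [-> Hs]]. rewrite cell_right.
    destruct j as [|j]; destruct Hs as [H|[H|[H|[]]]]; injection H; intros; subst;
      try discriminate; auto.
    right; split; auto. now rewrite cell_up.
  - intros [->|[-> ->]].
    + exists [1]. rewrite cell_right. destruct j; simpl; auto.
    + exists [0]. rewrite cell_up. simpl; auto.
Qed.

Lemma is_node_cell u : is_node grid u <-> exists i j, u = cell i j.
Proof.
  split.
  - induction 1 as [|u v Hu [i [j ->]] Hv]; [now exists 0, 0|].
    apply child_cell in Hv as [->|[-> ->]]; eauto.
  - intros [i [j ->]]. induction j as [|j IH].
    + induction i as [|i IH]; [apply node_root|].
      eapply node_child; [apply IH|]. apply child_cell; auto.
    + eapply node_child; [apply IH|]. apply child_cell; auto.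
Qed.

Lemma unfold_lab_cell i j p : unfold_lab grid (cell i j) p <-> j = 0 /\ p = 0.
Proof.
  unfold unfold_lab, cks_label. cbn [cks_init cks_lab grid]. rewrite last_cell. split.
  - intros [ps [[H|[]] Hp]]. injection H; intros <- E.
    destruct j; [|discriminate]. destruct Hp as [<-|[]]; auto.
  - intros [-> ->]. exists [0]. simpl; auto.
Qed.

(** The structure has a single component, so observing it along a node determines the node. *)
Lemma uniform_full p lam : uniform grid [0] p lam.
Proof.
  intros u v Hu Hv Huv.
  cut (u = v); [intros ->; tauto|].
  apply is_node_cell in Hu as [i [j ->]], Hv as [i' [j' ->]].
  assert (Hl : forall i j s, In s (cell i j) -> length s = 1).
  { intros a b s Hs. apply in_app_or in Hs as [Hs|Hs]; apply repeat_spec in Hs; now subst. }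
  specialize (Hl i j) as Hu. specialize (Hl i' j') as Hv. clear Hl.
  induction Huv as [|s s' l l' H _ IH]; auto.
  f_equal.
  - specialize (Hu s (or_introl eq_refl)). specialize (Hv s' (or_introl eq_refl)).
    specialize (H 0 (or_introl eq_refl)).
    destruct s as [|x [|]], s' as [|x' [|]]; simpl in *; congruence.
  - apply IH; intros; [apply Hu|apply Hv]; now right.
Qed.

Lemma obs_eq_nil u v : obs_eq [] u v <-> length u = length v.
Proof.
  split; [apply Forall2_length|].
  revert v; induction u as [|s u IH]; intros [|s' v] H; try discriminate; constructor.
  - intros i [].
  - apply IH. now injection H.
Qed.

(** Quantifiers change the labelling, so the meaning of the spine proposition 0 is carried along as
    an invariant; the formulas of the reduction never quantify 0. *)
Definition marked (lam : labelling) : Prop :=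
  forall i j, lam (cell i j) 0 <-> j = 0.

(** * Formulas evaluated on the grid *)

Notation sat lam f i j := (sat_s grid lam f (cell i j)).

Definition And f g := SNot (SOr (SNot f) (SNot g)).
Definition Imp f g := SOr (SNot f) g.
Definition Iff f g := And (Imp f g) (Imp g f).
Definition Top := SOr (SAP 0) (SNot (SAP 0)).
Definition Conj (l : list sform) := fold_right And Top l.
Definition EX f := SE (PX (PS f)).
Definition EF f := SE (PU (PS Top) (PS f)).
Definition AG_spine f := SNot (EF (And (SAP 0) (SNot f))).
Definition EX_right f := EX (And (SNot (SAP 0)) f).
Definition EX_up f := EX (And (SAP 0) f).
Definition All_levels f := SNot (SEx [] 1 (SNot f)).

Lemma sat_top K lam u : sat_s K lam Top u.
Proof. simpl. apply classic. Qed.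

Lemma sat_and K lam f g u :
  sat_s K lam (And f g) u <-> sat_s K lam f u /\ sat_s K lam g u.
Proof. simpl. tauto. Qed.

Lemma sat_imp K lam f g u :
  sat_s K lam (Imp f g) u <-> (sat_s K lam f u -> sat_s K lam g u).
Proof. simpl. tauto. Qed.

Lemma sat_iff K lam f g u :
  sat_s K lam (Iff f g) u <-> (sat_s K lam f u <-> sat_s K lam g u).
Proof. unfold Iff. rewrite sat_and, !sat_imp. tauto. Qed.

Lemma sat_conj K lam l u :
  sat_s K lam (Conj l) u <-> forall f, In f l -> sat_s K lam f u.
Proof.
  induction l as [|f l IH].
  - split; [intros _ f []|intros _; apply sat_top].
  - change (Conj (f :: l)) with (And f (Conj l)). rewrite sat_and, IH. split.
    + intros [Hf Hl] g [<-|Hg]; auto.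
    + intros H; split; [|intros g Hg]; apply H; simpl; auto.
Qed.

Lemma is_path_right i j : is_path grid (fun k => cell i (j + k)).
Proof. intros k. apply child_cell. left. f_equal; lia. Qed.

(** Supplies the infinite path behind each finite climb: up the spine for [d] steps, then right
    forever. *)
Lemma is_path_turn i d : is_path grid (fun k => cell (i + min k d) (k - d)).
Proof.
  intros k. apply child_cell. destruct (Nat.lt_ge_cases k d).
  - right. split; [lia|]. f_equal; lia.
  - left. f_equal; lia.
Qed.

(** Off the spine every node has exactly one child, so path quantifiers become deterministic
    there. *)
Lemma path_right pi i j k :
  is_path grid pi -> pi 0 = cell i (S j) -> pi k = cell i (S j + k).
Proof.
  intros Hp H0. induction k as [|k IH]; [rewrite H0; f_equal; lia|].
  specialize (Hp k). rewrite IH in Hp.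
  apply child_cell in Hp as [->|[H _]]; [f_equal; lia|lia].
Qed.

Lemma path_cell pi i k :
  is_path grid pi -> pi 0 = cell i 0 -> exists a b, pi k = cell a b /\ a + b = i + k.
Proof.
  intros Hp H0. induction k as [|k IH]; [exists i, 0; split; auto; lia|].
  destruct IH as [a [b [E IH]]]. specialize (Hp k). rewrite E in Hp.
  apply child_cell in Hp as [->|[-> ->]]; [exists a, (S b)|exists (S a), 0];
    split; auto; lia.
Qed.

Lemma sat_EX lam f i j :
  sat lam (EX f) i j <-> exists v, child grid (cell i j) v /\ sat_s grid lam f v.
Proof.
  split.
  - intros [pi [Hp [H0 H]]]. exists (pi 1). split; auto. rewrite <- H0. apply Hp.
  - intros [v [Hv H]]. apply child_cell in Hv as [->|[-> ->]].
    + exists (fun k => cell i (j + k)). split; [apply is_path_right|].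
      rewrite Nat.add_0_r. split; auto. simpl. unfold suffix.
      now replace (j + (1 + 0)) with (S j) by lia.
    + exists (fun k => cell (i + min k 1) (k - 1)). split; [apply is_path_turn|].
      split; [f_equal; lia|]. simpl. unfold suffix. simpl.
      now replace (i + 1) with (S i) by lia.
Qed.

Lemma sat_EX_right lam f i :
  marked lam -> (sat lam (EX_right f) i 0 <-> sat lam f i 1).
Proof.
  intros Hm. unfold EX_right. rewrite sat_EX. split.
  - intros [v [Hv H]]. apply sat_and in H as [Ha H]. simpl in Ha.
    apply child_cell in Hv as [->|[_ ->]]; auto. now rewrite (Hm _ 0) in Ha.
  - intros H. exists (cell i 1). rewrite child_cell, sat_and. simpl.
    split; auto. split; auto. rewrite (Hm _ 1). discriminate.
Qed.

Lemma sat_EX_up lam f i :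
  marked lam -> (sat lam (EX_up f) i 0 <-> sat lam f (S i) 0).
Proof.
  intros Hm. unfold EX_up. rewrite sat_EX. split.
  - intros [v [Hv H]]. apply sat_and in H as [Ha H]. simpl in Ha.
    apply child_cell in Hv as [->|[_ ->]]; auto. now apply (Hm _ 1) in Ha.
  - intros H. exists (cell (S i) 0). rewrite child_cell, sat_and. simpl.
    split; auto. split; auto. now apply (Hm _ 0).
Qed.

Lemma sat_EX_tail lam f i j : sat lam (EX f) i (S j) <-> sat lam f i (S (S j)).
Proof.
  rewrite sat_EX. split.
  - intros [v [Hv H]]. now apply child_cell in Hv as [->|[E _]].
  - intros H. exists (cell i (S (S j))). rewrite child_cell. auto.
Qed.

Lemma sat_EX_iter lam f k i j :
  sat lam (Nat.iter k EX f) i (S j) <-> sat lam f i (S j + k).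
Proof.
  revert j; induction k as [|k IH]; intros j.
  - now rewrite Nat.add_0_r.
  - rewrite Nat.iter_succ, sat_EX_tail, IH. now rewrite Nat.add_succ_r.
Qed.

Lemma sat_EF_tail lam f i j :
  sat lam (EF f) i (S j) <-> exists k, sat lam f i (S j + k).
Proof.
  split.
  - intros [pi [Hp [H0 [k [H _]]]]]. exists k. rewrite <- (path_right pi) by auto.
    simpl in H. unfold suffix in H. now rewrite Nat.add_0_r in H.
  - intros [k H]. exists (fun k => cell i (S j + k)). split; [apply is_path_right|].
    split; [f_equal; lia|]. exists k. split.
    + simpl. unfold suffix. now rewrite Nat.add_0_r.
    + intros. apply sat_top.
Qed.

Lemma sat_AG_spine lam f :
  marked lam -> (sat lam (AG_spine f) 0 0 <-> forall i, sat lam f i 0).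
Proof.
  intros Hm. unfold AG_spine. split.
  - intros H i. apply NNPP. intros Hn. apply H.
    exists (fun k => cell (0 + min k i) (k - i)). split; [apply is_path_turn|].
    split; [reflexivity|]. exists i. split; [|intros; apply sat_top].
    cbn [sat_p]. unfold suffix. rewrite Nat.add_0_r, Nat.min_id, Nat.sub_diag.
    apply sat_and. split; [|exact Hn]. now apply (Hm _ 0).
  - intros H [pi [Hp [H0 [k [Hk _]]]]]. cbn [sat_p] in Hk.
    apply sat_and in Hk as [Ha Hn]. unfold suffix in *.
    destruct (path_cell pi 0 (k + 0) Hp H0) as [a [b [E _]]].
    rewrite E in *. apply (Hm a b) in Ha. subst b. exact (Hn (H a)).
Qed.

(** For every level set, some mark of this row moved [k] levels down falls in it iff some mark of
    the next row does. Quantifying over all level sets forces the two sets of levels to be equal. *)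
Definition Level_shift (p k : nat) : sform :=
  All_levels
    (Iff (EX_right (EF (And (SAP p) (Nat.iter k EX (SAP 1)))))
         (EX_up (EX_right (EF (And (SAP p) (SAP 1)))))).

Lemma sat_EX_right_EF lam p k i (Q : nat -> Prop) :
  marked lam -> (forall a b, lam (cell a b) 1 <-> Q (a + b)) ->
  (sat lam (EX_right (EF (And (SAP p) (Nat.iter k EX (SAP 1))))) i 0 <->
   exists v, lam (cell i (S v)) p /\ Q (i + S v + k)).
Proof.
  intros Hm HQ. rewrite sat_EX_right, sat_EF_tail by auto.
  split; intros [v H]; exists v; rewrite sat_and in *; rewrite sat_EX_iter in *; simpl in *;
    rewrite HQ in *; rewrite <- ?Nat.add_assoc in *; auto.
Qed.

Definition relabel (lam : labelling) (p : nat) (V : node -> Prop) : labelling :=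
  fun v q => if q =? p then V v else lam v q.

Lemma relabel_same lam p V v : relabel lam p V v p = V v.
Proof. unfold relabel. now rewrite Nat.eqb_refl. Qed.

Lemma relabel_other lam p V v q : q <> p -> relabel lam p V v q = lam v q.
Proof. intros H. unfold relabel. now apply Nat.eqb_neq in H as ->. Qed.

Lemma sat_All_levels lam f i j :
  sat lam (All_levels f) i j <->
  forall lam', (forall v q, q <> 1 -> (lam' v q <-> lam v q)) ->
    uniform grid [] 1 lam' -> sat lam' f i j.
Proof.
  split.
  - intros H lam' H1 H2. apply NNPP. intros Hn. apply H. now exists lam'.
  - intros H [lam' [H1 [H2 Hn]]]. now apply Hn, H.
Qed.

(** The next row starts one level lower, so a mark at offset [v] reappears at offset [v + k - 1].
    The condition [0 < v + k] excludes the level of the next spine cell, which the right-hand side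
    of the equivalence never inspects. *)
Lemma sat_Level_shift lam p k i :
  marked lam -> p <> 1 ->
  (sat lam (Level_shift p k) i 0 <->
   (forall v, lam (cell i (S v)) p -> 0 < v + k) /\
   forall w, lam (cell (S i) (S w)) p <-> exists v, lam (cell i (S v)) p /\ v + k = S w).
Proof.
  intros Hm Hp. unfold Level_shift. rewrite sat_All_levels. split.
  - intros H.
    assert (HQ : forall Q : nat -> Prop,
      (exists v, lam (cell i (S v)) p /\ Q (i + S v + k)) <->
      (exists w, lam (cell (S i) (S w)) p /\ Q (S i + S w + 0))).
    (* The root has length 1 and level 0, hence the [pred]. *)
    { intros Q. specialize (H (relabel lam 1 (fun v => Q (pred (length v))))).
      set (lam' := relabel lam 1 (fun v => Q (pred (length v)))) in H.
      assert (Hm' : marked lam').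
      { intros a b. unfold lam'. rewrite relabel_other by lia. apply Hm. }
      assert (HL : forall a b, lam' (cell a b) 1 <-> Q (a + b)).
      { intros a b. unfold lam'. rewrite relabel_same, length_cell. reflexivity. }
      rewrite sat_iff, (sat_EX_up _ _ _ Hm') in H.
      rewrite (sat_EX_right_EF lam' p k i Q), (sat_EX_right_EF lam' p 0 (S i) Q) in H by auto.
      unfold lam' in H.
      assert (E : forall a b, relabel lam 1 (fun v => Q (pred (length v))) (cell a b) p = lam (cell a b) p)
        by (intros; now apply relabel_other).
      setoid_rewrite E in H. apply H.
      - intros v q Hq. now rewrite relabel_other.
      - intros u v _ _ Huv. apply obs_eq_nil in Huv.
        rewrite !relabel_same, Huv. reflexivity. }
    split.
    (* A singleton level set isolates the level of one mark and yields a mark of the other row on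
       it. *)
    + intros v Hv. destruct (proj1 (HQ (fun d => d = i + S v + k))) as [w [_ E]]; eauto. lia.
    + intros w. split.
      * intros Hw. destruct (proj2 (HQ (fun d => d = S i + S w + 0))) as [v [Hv E]]; eauto.
        exists v. split; auto. lia.
      * intros [v [Hv E]].
        destruct (proj1 (HQ (fun d => d = i + S v + k))) as [w' [Hw E']]; eauto.
        now replace w with w' by lia.
  - intros [H0 H] lam' Ho Hu.
    assert (Hm' : marked lam').
    { intros a b. rewrite Ho by lia. apply Hm. }
    (* Uniformity under the empty observation makes proposition 1 constant on each level, so it is
       determined by the set of levels where it holds somewhere. *)
    set (Q := fun d => exists u, is_node grid u /\ length u = S d /\ lam' u 1).
    assert (HL : forall a b, lam' (cell a b) 1 <-> Q (a + b)).
    { intros a b. split.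
      - intros Hc. exists (cell a b). repeat split; auto; [|apply length_cell].
        apply is_node_cell; eauto.
      - intros [u [Hn [Hl Hc]]]. apply (Hu u); auto.
        + apply is_node_cell; eauto.
        + apply obs_eq_nil. rewrite length_cell. lia. }
    rewrite sat_iff, (sat_EX_up _ _ _ Hm').
    rewrite (sat_EX_right_EF lam' p k i Q), (sat_EX_right_EF lam' p 0 (S i) Q) by auto.
    setoid_rewrite (fun v => Ho v p Hp). split.
    + intros [v [Hv HQ]]. specialize (H0 v Hv).
      exists (pred (v + k)). split; [apply H; exists v; split; auto; lia|].
      now replace (S i + S (pred (v + k)) + 0) with (i + S v + k) by lia.
    + intros [w [Hw HQ]]. apply H in Hw as [v [Hv E]]. exists v. split; auto.
      now replace (i + S v + k) with (S i + S w + 0) by lia.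
Qed.

Fixpoint SEx_full (ps : list nat) (f : sform) : sform :=
  match ps with [] => f | p :: ps' => SEx [0] p (SEx_full ps' f) end.

(** By [uniform_full] the quantifiers are unrestricted, so the block amounts to one arbitrary
    relabelling of [ps]. *)
Lemma sat_SEx_full ps lam f u :
  sat_s grid lam (SEx_full ps f) u <->
  exists lam', (forall v q, ~ In q ps -> (lam' v q <-> lam v q)) /\ sat_s grid lam' f u.
Proof.
  revert lam; induction ps as [|p ps IH]; intros lam; simpl.
  - split; [intros H; exists lam; split; auto; tauto|].
    intros [lam' [E H]]. replace lam with lam'; auto.
    apply functional_extensionality; intros v.
    apply functional_extensionality; intros q.
    apply propositional_extensionality. apply E. auto.
  - split.
    + intros [lam1 [H1 [_ H]]]. apply IH in H as [lam' [H2 H]]. exists lam'.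
      split; auto. intros v q Hq. rewrite H2 by tauto. apply H1. intros ->; auto.
    + intros [lam' [H1 H]]. exists (relabel lam p (fun v => lam' v p)).
      split; [intros v q Hq; now rewrite relabel_other|].
      split; [apply uniform_full|]. apply IH. exists lam'. split; auto.
      intros v q Hq. destruct (Nat.eq_dec q p) as [->|Hqp].
      * now rewrite relabel_same.
      * rewrite relabel_other by auto. apply H1. intuition congruence.
Qed.

(** * Encoding runs of a machine *)

Definition bound (M : program) : nat :=
  fold_right (fun i n => match i with INC r => r + n | DEC r j => r + j + n end)
             (length M) M.

Lemma bound_length M : length M <= bound M.
Proof.
  unfold bound. generalize (length M) at 1 2. intros l.
  induction M as [|[r|r j] M IH]; simpl; lia.
Qed.

Lemma bound_instr M pc i :
  nth_error M pc = Some i ->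
  match i with INC r => r <= bound M | DEC r j => r <= bound M /\ j <= bound M end.
Proof.
  intros H. apply nth_error_In in H. unfold bound.
  generalize (length M). intros l.
  induction M as [|i' M IH]; [destruct H|].
  destruct H as [->|H]; [destruct i; simpl; lia|].
  specialize (IH H); destruct i, i'; simpl in *; lia.
Qed.

(** The range also covers the addresses at which the machine halts, since [run_form] must rule those
    out one by one. *)
Lemma step_bound M pc g : pc <= bound M -> fst (step M (pc, g)) <= bound M.
Proof.
  intros H. simpl. destruct (nth_error M pc) as [i|] eqn:E; auto.
  assert (pc < length M) by (apply nth_error_Some; congruence).
  assert (HL := bound_length M). apply bound_instr in E.
  destruct i; simpl; [lia|]. destruct (g r =? 0); simpl; lia.
Qed.

(* Row [i] of the grid is the configuration at time [i]: [pc_prop l] holds at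
   [cell i 0] when the program counter is [l], and [reg_prop r] holds at
   [cell i (S v)] when register [r] contains [v]. *)
Definition pc_prop (l : nat) : nat := 2 * l + 2.
Definition reg_prop (r : nat) : nat := 2 * r + 3.

Definition update_regs (N : nat) (d : nat -> nat) : sform :=
  Conj (map (fun r => Level_shift (reg_prop r) (d r)) (seq 0 (S N))).

Definition goto (l : nat) : sform := EX_up (SAP (pc_prop l)).

Definition is_zero (r : nat) : sform := EX_right (SAP (reg_prop r)).

(* Going down one row shifts levels by one, so a register is incremented, kept or
   decremented when its mark moves by 2, 1 or 0 levels. *)
Definition instr_form (N l : nat) (i : option instr) : sform :=
  match i with
  | None => SNot Top
  | Some (INC r) =>
      And (goto (S l)) (update_regs N (fun r' => if r' =? r then 2 else 1))
  | Some (DEC r j) =>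
      And (Imp (is_zero r) (And (goto j) (update_regs N (fun _ => 1))))
          (Imp (SNot (is_zero r))
               (And (goto (S l)) (update_regs N (fun r' => if r' =? r then 0 else 1))))
  end.

Definition run_form (M : program) : sform :=
  let N := bound M in
  Conj (map (fun l => AG_spine (Imp (SAP (pc_prop l)) (instr_form N l (nth_error M l))))
            (seq 0 (S N))).

Definition unique_mark (p : nat) : sform :=
  SNot (EX_right (EF (And (SAP p) (EX (EF (SAP p)))))).

(** Register 0 gets at most one mark but no prescribed position: the input is fixed elsewhere, which
    keeps this formula independent of it. *)
Definition init_form (N : nat) : sform :=
  And (SAP (pc_prop 0))
  (And (unique_mark (reg_prop 0))
       (Conj (map (fun r => And (unique_mark (reg_prop r)) (is_zero r)) (seq 1 N)))).

(** The actual program counter must be marked, but other addresses may be marked too: they only add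
    constraints through [run_form]. *)
Definition config_row (N : nat) (lam : labelling) (i : nat) (c : config) : Prop :=
  lam (cell i 0) (pc_prop (fst c)) /\
  forall r, r <= N -> forall v, lam (cell i (S v)) (reg_prop r) <-> v = snd c r.

Lemma sat_unique_mark lam p :
  marked lam ->
  (sat lam (unique_mark p) 0 0 <->
   forall v w, lam (cell 0 (S v)) p -> lam (cell 0 (S w)) p -> v = w).
Proof.
  intros Hm. unfold unique_mark. cbn [sat_s].
  rewrite sat_EX_right, sat_EF_tail by auto. split.
  - intros H.
    assert (L : forall v w, v < w -> lam (cell 0 (S v)) p -> lam (cell 0 (S w)) p -> False).
    { intros v w Hvw Hv Hw. apply H. exists v. apply sat_and. split; auto.
      apply (sat_EX_tail lam (EF (SAP p)) 0 v), sat_EF_tail. exists (w - S v).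
      now replace (S (S v) + (w - S v)) with (S w) by lia. }
    intros v w Hv Hw. destruct (Nat.lt_trichotomy v w) as [|[|]]; auto; exfalso; eauto.
  - intros H [k Hk]. apply sat_and in Hk as [Hv Hw].
    apply sat_EX_tail, sat_EF_tail in Hw as [k' Hw].
    specialize (H k (S k + k') Hv Hw). lia.
Qed.

Lemma sat_update_regs lam N d i :
  marked lam ->
  (sat lam (update_regs N d) i 0 <->
   forall r, r <= N ->
   (forall v, lam (cell i (S v)) (reg_prop r) -> 0 < v + d r) /\
   forall w, lam (cell (S i) (S w)) (reg_prop r) <->
             exists v, lam (cell i (S v)) (reg_prop r) /\ v + d r = S w).
Proof.
  intros Hm. unfold update_regs. rewrite sat_conj.
  assert (E : forall r, sat lam (Level_shift (reg_prop r) (d r)) i 0 <-> _)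
    by (intros r; apply sat_Level_shift; [auto|unfold reg_prop; lia]).
  split.
  - intros H r Hr. apply E, H. apply in_map_iff. exists r. split; auto.
    apply in_seq. lia.
  - intros H f Hf. apply in_map_iff in Hf as [r [<- Hr]]. apply in_seq in Hr.
    apply E, H. lia.
Qed.

Lemma sat_is_zero lam N i c r :
  marked lam -> config_row N lam i c -> r <= N ->
  (sat lam (is_zero r) i 0 <-> snd c r = 0).
Proof.
  intros Hm [_ H] Hr. unfold is_zero. rewrite sat_EX_right by auto.
  simpl. rewrite H by auto. split; auto.
Qed.

(** A shift by [d r] changes the offset by [d r - 1], which is what the equation expresses; since
    [S (g r)] is positive, the side condition of [sat_update_regs] is automatic. *)
Lemma sat_update_regs_row lam N d i c g :
  marked lam -> config_row N lam i c ->
  (forall r, r <= N -> snd c r + d r = S (g r)) ->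
  (sat lam (update_regs N d) i 0 <->
   forall r, r <= N -> forall w, lam (cell (S i) (S w)) (reg_prop r) <-> w = g r).
Proof.
  intros Hm [_ H] Hg. rewrite sat_update_regs by auto.
  split; intros HU r Hr; specialize (Hg r Hr); specialize (HU r Hr); specialize (H r Hr).
  - intros w. destruct HU as [_ HU]. rewrite HU. split.
    + intros [v [Hv E]]. apply H in Hv. lia.
    + intros ->. exists (snd c r). rewrite H. auto.
  - split.
    + intros v Hv. apply H in Hv. lia.
    + intros w. rewrite HU. split.
      * intros ->. exists (snd c r). rewrite H. auto.
      * intros [v [Hv E]]. apply H in Hv. lia.
Qed.

Lemma sat_instr_form lam M i c ins :
  marked lam -> config_row (bound M) lam i c ->
  nth_error M (fst c) = Some ins ->
  (sat lam (instr_form (bound M) (fst c) (Some ins)) i 0 <->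
   config_row (bound M) lam (S i) (step M c)).
Proof.
  destruct c as [pc g]. cbn [fst]. intros Hm Hc Hi.
  assert (Hb := bound_instr _ _ _ Hi).
  unfold step. rewrite Hi. unfold config_row at 1.
  destruct ins as [r|r j]; unfold instr_form; rewrite sat_and.
  - unfold goto. rewrite sat_EX_up by auto. cbn [fst snd].
    rewrite (sat_update_regs_row _ _ _ _ _ (upd g r (S (g r))) Hm Hc); [reflexivity|].
    intros r' _. simpl. unfold upd. destruct (Nat.eqb_spec r' r); subst; lia.
  - destruct Hb as [Hr Hj]. rewrite !sat_imp, !sat_and.
    assert (Hz := sat_is_zero _ _ _ _ r Hm Hc Hr). cbn [snd] in Hz.
    replace (sat lam (SNot (is_zero r)) i 0) with (~ sat lam (is_zero r) i 0) by reflexivity.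
    rewrite Hz. unfold goto. rewrite !sat_EX_up by auto.
    destruct (Nat.eqb_spec (g r) 0) as [E|E]; cbn [fst snd].
    + rewrite (sat_update_regs_row _ _ (fun _ => 1) _ _ g Hm Hc) by (simpl; intros; lia).
      simpl. tauto.
    + rewrite (sat_update_regs_row _ _ (fun r' => if r' =? r then 0 else 1) _ _
                 (upd g r (pred (g r))) Hm Hc).
      * simpl. tauto.
      * intros r' _. simpl. unfold upd. destruct (Nat.eqb_spec r' r); subst; lia.
Qed.

Lemma sat_run_form lam M :
  marked lam ->
  (sat lam (run_form M) 0 0 <->
   forall l, l <= bound M -> forall i, lam (cell i 0) (pc_prop l) ->
     sat lam (instr_form (bound M) l (nth_error M l)) i 0).
Proof.
  intros Hm. unfold run_form. rewrite sat_conj. split.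
  - intros H l Hl i Hi.
    assert (Hs : sat lam (AG_spine (Imp (SAP (pc_prop l))
                   (instr_form (bound M) l (nth_error M l)))) 0 0).
    { apply H. apply in_map_iff. exists l. split; auto. apply in_seq. lia. }
    rewrite sat_AG_spine in Hs by auto. specialize (Hs i).
    rewrite sat_imp in Hs. auto.
  - intros H f Hf. apply in_map_iff in Hf as [l [<- Hl]]. apply in_seq in Hl.
    apply sat_AG_spine; auto. intros i. apply sat_imp. intros Hi.
    apply H; auto. lia.
Qed.

(** By induction on time each row forces the next one; a halted row would have to satisfy
    [SNot Top]. *)
Lemma sat_run_form_rows lam M c :
  marked lam -> fst c <= bound M -> config_row (bound M) lam 0 c ->
  sat lam (run_form M) 0 0 ->
  forall i, config_row (bound M) lam i (run M i c) /\ ~ halted M (run M i c).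
Proof.
  intros Hm Hb H0 HF. rewrite sat_run_form in HF by auto.
  assert (Hbi : forall i, fst (run M i c) <= bound M).
  { induction i; auto. rewrite run_succ. destruct (run M i c). now apply step_bound. }
  assert (Hrow : forall i, config_row (bound M) lam i (run M i c) -> ~ halted M (run M i c)).
  { intros i Hi Hh. specialize (HF _ (Hbi i) i (proj1 Hi)). unfold halted in Hh.
    rewrite Hh in HF. apply HF, sat_top. }
  induction i as [|i [IH Hn]]; [split; auto|].
  cut (config_row (bound M) lam (S i) (run M (S i) c)); [split; auto|].
  rewrite run_succ. unfold halted in Hn.
  destruct (nth_error M (fst (run M i c))) as [ins|] eqn:E; [|tauto].
  apply (sat_instr_form _ _ _ _ _ Hm IH E). rewrite <- E. apply HF; auto. apply IH.
Qed.

Lemma sat_init_form lam N x :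
  marked lam ->
  (lam (cell 0 (S x)) (reg_prop 0) /\ sat lam (init_form N) 0 0 <->
   config_row N lam 0 (init_config x)).
Proof.
  intros Hm. unfold init_form, config_row. rewrite !sat_and, sat_conj.
  assert (HU : forall r v0, lam (cell 0 (S v0)) (reg_prop r) /\
      sat lam (unique_mark (reg_prop r)) 0 0 <->
      forall v, lam (cell 0 (S v)) (reg_prop r) <-> v = v0).
  { intros r v0. rewrite sat_unique_mark by auto. split.
    - intros [H0 H] v. split; [|intros ->]; auto.
    - intros H. split; [now apply H|]. intros v w Hv Hw. apply H in Hv, Hw. congruence. }
  assert (HZ : forall r, sat lam (is_zero r) 0 0 <-> lam (cell 0 1) (reg_prop r))
    by (intros r; unfold is_zero; now rewrite sat_EX_right).
  split.
  - intros [Hx [Hpc [H0 H]]]. split; [exact Hpc|].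
    intros [|r] Hr.
    + simpl. apply HU. auto.
    + simpl. apply HU. specialize (H (And (unique_mark (reg_prop (S r))) (is_zero (S r)))).
      rewrite sat_and, HZ in H. apply and_comm, H.
      apply in_map_iff. exists (S r). split; auto. apply in_seq. lia.
  - intros [Hpc H].
    assert (H0 := proj2 (HU 0 x) (H 0 (Nat.le_0_l N))).
    split; [tauto|]. split; [exact Hpc|]. split; [tauto|].
    intros f Hf. apply in_map_iff in Hf as [r [<- Hr]]. apply in_seq in Hr.
    assert (Hr' := proj2 (HU r 0)). rewrite sat_and, HZ. apply and_comm, Hr'.
    intros v. rewrite (H r) by lia. destruct r; [lia|reflexivity].
Qed.

(** The intended model. Restricting to [r <= bound M] keeps it equal to the unfolding outside the
    quantified propositions. *)
Definition run_labelling (M : program) (x : nat) : labelling := fun v q =>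
  unfold_lab grid v q \/
  exists i, let c := run M i (init_config x) in
    (v = cell i 0 /\ q = pc_prop (fst c)) \/
    (exists r, r <= bound M /\ v = cell i (S (snd c r)) /\ q = reg_prop r).

Lemma run_labelling_marked M x : marked (run_labelling M x).
Proof.
  intros i j. unfold run_labelling. rewrite unfold_lab_cell. split; [|auto].
  intros [[H _]|[k [[_ H]|[r [_ [_ H]]]]]]; auto; unfold pc_prop, reg_prop in H; lia.
Qed.

Lemma run_labelling_pc M x i l :
  run_labelling M x (cell i 0) (pc_prop l) <-> l = fst (run M i (init_config x)).
Proof.
  unfold run_labelling. rewrite unfold_lab_cell. split.
  - intros [[_ H]|[k [[Hc H]|[r [_ [Hc H]]]]]].
    + unfold pc_prop in H; lia.
    + apply cell_inj in Hc as [-> _]. unfold pc_prop in H; lia.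
    + apply cell_inj in Hc as [_ Hc]. lia.
  - intros ->. right. exists i. auto.
Qed.

Lemma run_labelling_row M x i :
  config_row (bound M) (run_labelling M x) i (run M i (init_config x)).
Proof.
  split; [now apply run_labelling_pc|].
  intros r Hr v. unfold run_labelling. rewrite unfold_lab_cell. split.
  - intros [[H _]|[k [[Hc _]|[r' [_ [Hc H]]]]]]; [lia| |].
    + apply cell_inj in Hc as [_ Hc]. lia.
    + apply cell_inj in Hc as [-> Hc]. unfold reg_prop in H.
      replace r' with r in Hc by lia. lia.
  - intros ->. right. exists i. right. exists r. auto.
Qed.

Lemma run_labelling_run_form M x :
  ~ halts M x -> sat (run_labelling M x) (run_form M) 0 0.
Proof.
  intros Hh. assert (Hm := run_labelling_marked M x).
  apply sat_run_form; auto. intros l _ i Hl. apply run_labelling_pc in Hl as ->.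
  destruct (nth_error M (fst (run M i (init_config x)))) as [ins|] eqn:E.
  - apply sat_instr_form; auto; [apply run_labelling_row|].
    rewrite <- run_succ. apply run_labelling_row.
  - exfalso. apply Hh. now exists i.
Qed.

(** * The instance for a machine and an input *)

Definition machine_form (M : program) : sform :=
  let N := bound M in
  SNot (SEx_full (map pc_prop (seq 0 (S N)) ++ map reg_prop (seq 1 N))
                 (And (init_form N) (run_form M))).

(** The iteration is over the path operator [PX], so each round adds a single tag 3 to the code. *)
Definition no_input_form (x : nat) : sform :=
  SNot (SE (PX (PNot (POr (PS (SAP 0)) (PNot (Nat.iter x PX (PS (SAP (reg_prop 0))))))))).

(** A conjunction written as a negated disjunction of already negated parts, so that the code of [f]
    occurs unwrapped in a pair. Register 0 is quantified outside because [f] and the input condition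
    share it. *)
Definition instance_form (f : sform) (x : nat) : sform :=
  SEx [0] (reg_prop 0) (SNot (SOr f (no_input_form x))).

Lemma sat_PX_iter K lam p k pi :
  sat_p K lam (Nat.iter k PX (PS (SAP p))) pi <-> lam (pi k) p.
Proof.
  revert pi; induction k as [|k IH]; intros pi; [reflexivity|].
  rewrite Nat.iter_succ. cbn [sat_p]. rewrite IH. reflexivity.
Qed.

Lemma sat_no_input_form lam x :
  marked lam ->
  (sat lam (no_input_form x) 0 0 <-> ~ lam (cell 0 (S x)) (reg_prop 0)).
Proof.
  intros Hm. unfold no_input_form. cbn [sat_s]. apply not_iff_compat. split.
  - intros [pi [Hp [H0 H]]]. cbn [sat_p sat_s] in H. rewrite sat_PX_iter in H.
    assert (Hc : child grid (cell 0 0) (pi 1)) by (rewrite <- H0; apply Hp).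
    unfold suffix in H. cbn [Nat.add] in H.
    apply child_cell in Hc as [Hc|[_ Hc]].
    + assert (Hx : lam (pi (S x)) (reg_prop 0)) by tauto.
      enough (E : pi (S x) = cell 0 (S x)) by now rewrite <- E.
      (* The path is off the spine after one step, hence confined to row 0. *)
      apply (path_right (suffix pi 1) 0 0 x); auto. intros k. apply Hp.
    + exfalso. apply H. left. rewrite Hc. now apply (Hm _ 0).
  - intros H. exists (fun k => cell 0 (0 + k)). split; [apply is_path_right|].
    split; auto. cbn [sat_p sat_s]. rewrite sat_PX_iter. unfold suffix. simpl.
    rewrite (Hm 0 1). intros [E|E]; [discriminate|]. auto.
Qed.

(** A satisfying labelling decodes to a run that never halts. Conversely [run_labelling] is split
    between the outer quantifier, which takes register 0, and the inner block, which takes the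
    rest. *)
Lemma model_check_machine M x :
  model_check grid (instance_form (machine_form M) x) <-> ~ halts M x.
Proof.
  unfold model_check, instance_form, machine_form. change [cks_init grid] with (cell 0 0).
  set (ps := map pc_prop _ ++ _).
  assert (Hps : forall q, In q ps ->
    q <> reg_prop 0 /\ q <> 0).
  { intros q Hq. unfold ps in Hq.
    apply in_app_or in Hq as [Hq|Hq]; apply in_map_iff in Hq as [r [<- Hr]];
      apply in_seq in Hr; unfold pc_prop, reg_prop; lia. }
  split.
  - intros [lam1 [H1 [_ H]]]. cbn [sat_s] in H.
    assert (Hm1 : marked lam1).
    { intros i j. rewrite H1, unfold_lab_cell by (unfold reg_prop; lia). tauto. }
    rewrite sat_SEx_full, sat_no_input_form in H by auto.
    apply not_or_and in H as [HF Hx]. apply NNPP in HF, Hx.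
    destruct HF as [lam [H2 HF]]. apply sat_and in HF as [Hi Hr].
    assert (Hm : marked lam).
    { intros i j. rewrite H2; [apply Hm1|]. intros Hq. now apply Hps in Hq. }
    assert (Hrow : config_row (bound M) lam 0 (init_config x)).
    { apply sat_init_form; auto. split; auto. apply H2; auto.
      intros Hq. now apply Hps in Hq. }
    intros [k Hk]. now apply (sat_run_form_rows lam M (init_config x) Hm
      (Nat.le_0_l _) Hrow Hr k).
  - intros Hh.
    assert (Hm := run_labelling_marked M x).
    assert (Hrow := run_labelling_row M x 0).
    apply sat_init_form in Hrow as [Hx Hi]; auto.
    set (lam := run_labelling M x) in *.
    set (lam1 := relabel (unfold_lab grid) (reg_prop 0) (fun v => lam v (reg_prop 0))).
    assert (Hm1 : marked lam1).
    { intros i j. unfold lam1. rewrite relabel_other, unfold_lab_cell by (unfold reg_prop; lia).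
      tauto. }
    exists lam1. split; [intros v q Hq; unfold lam1; now rewrite relabel_other|].
    split; [apply uniform_full|]. cbn [sat_s].
    rewrite sat_SEx_full, sat_no_input_form by auto.
    intros [H|H]; apply H.
    + exists lam. split; [|apply sat_and; split; auto; now apply run_labelling_run_form].
      intros v q Hq. unfold lam1.
      destruct (Nat.eq_dec q (reg_prop 0)) as [->|Hq0]; [now rewrite relabel_same|].
      rewrite relabel_other by auto.
      split; [|intros Hl; now left].
      (* Everything the run adds is quantified, by the bounds on addresses and registers. *)
      intros [Hl|[i [[_ E]|[r [Hr [_ E]]]]]]; auto; exfalso; apply Hq; rewrite E;
        apply in_or_app.
      * left. apply in_map, in_seq. split; [lia|].
        enough (fst (run M i (init_config x)) <= bound M) by lia.
        clear. induction i; [apply Nat.le_0_l|].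
        rewrite run_succ. destruct (run M i (init_config x)). now apply step_bound.
      * right. apply in_map, in_seq. destruct r; [congruence|lia].
    + unfold lam1. now rewrite relabel_same.
Qed.

(** * Undecidability *)

Lemma obs_ok_Conj n l : (forall f, In f l -> obs_ok_s n f) -> obs_ok_s n (Conj l).
Proof.
  induction l as [|f l IH]; intros H; simpl; auto.
  repeat split; [|apply IH; intros]; apply H; simpl; auto.
Qed.

Lemma obs_ok_EX_iter n k p : obs_ok_s n (Nat.iter k EX (SAP p)).
Proof. induction k; simpl; auto. Qed.

Lemma obs_ok_update_regs n N d : obs_ok_s n (update_regs N d).
Proof.
  apply obs_ok_Conj. intros f Hf. apply in_map_iff in Hf as [r [<- _]].
  simpl. repeat split; auto using obs_ok_EX_iter; intros _ [].
Qed.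

Lemma obs_ok_SEx_full ps f : obs_ok_s 1 f -> obs_ok_s 1 (SEx_full ps f).
Proof.
  intros H. induction ps; simpl; auto. split; auto. intros i [<-|[]]; auto.
Qed.

Lemma obs_ok_instr_form n N l i : obs_ok_s n (instr_form N l i).
Proof.
  destruct i as [[r|r j]|]; cbn -[update_regs]; auto 10 using obs_ok_update_regs.
Qed.

Lemma wf_instance_form M x : wf_instance grid (instance_form (machine_form M) x).
Proof.
  split; [apply wf_grid|]. split; [intros i [<-|[]]; auto|].
  split.
  - unfold machine_form. cbn [obs_ok_s cks_n grid].
    apply obs_ok_SEx_full. split.
    + simpl. repeat split. apply obs_ok_Conj. intros f Hf.
      apply in_map_iff in Hf as [r [<- _]]. simpl. tauto.
    + apply obs_ok_Conj. intros f Hf. apply in_map_iff in Hf as [r [<- _]].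
      cbn -[instr_form]. auto 10 using obs_ok_instr_form.
  - simpl. split; auto. induction x; simpl; auto.
Qed.

Lemma enc_p_PX_iter k psi : enc_p (Nat.iter k PX psi) = Nat.iter k (cpair 3) (enc_p psi).
Proof.
  induction k as [|k IH]; [reflexivity|]. rewrite !Nat.iter_succ, <- IH. reflexivity.
Qed.

(** The lists are the tags and side data met on the way down to [f] and to the block of [PX]; this
    is the output shape of [diagonal_com]. *)
Lemma enc_instance_form f x :
  enc_instance grid (instance_form f x) =
  fold_right cpair
    (cpair (enc_s f)
       (fold_right cpair (Nat.iter x (cpair 3) (enc_p (PS (SAP (reg_prop 0)))))
          [1; 3; 3; 1; 2; enc_p (PS (SAP 0)); 1]))
    [enc_CKS grid; 4; enc_list (fun i => i) [0]; reg_prop 0; 1; 2].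
Proof.
  rewrite <- enc_p_PX_iter. unfold enc_instance, instance_form, no_input_form.
  cbn [enc_s enc_p fold_right]. reflexivity.
Qed.

(* No counter machine decides the model-checking problem for QCTL*_i
   under tree semantics (on the standard encoding of instances). *)
Theorem theorem3 :
  ~ exists P : program,
      forall (K : CKS) (f : sform), wf_instance K f ->
        MM_answers P (enc_instance K f) (model_check K f).
Proof.
  intros [P HP].
  set (s := enc_p (PS (SAP (reg_prop 0)))).
  set (inner := [1; 3; 3; 1; 2; enc_p (PS (SAP 0)); 1]).
  set (outer := [enc_CKS grid; 4; enc_list (fun i => i) [0]; reg_prop 0; 1; 2]).
  set (D := diagonal_machine P (diagonal_com s 3 inner outer)).
  (* [D] is built without [x], so there is no circularity in running it on the code of its own
     formula. *)
  set (x := enc_s (machine_form D)).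
  specialize (HP grid (instance_form (machine_form D) x) (wf_instance_form D x)).
  rewrite enc_instance_form in HP.
  assert (H := diagonal_machine_halts P _ x _ _ (diagonal_com_correct s 3 inner outer x) HP).
  rewrite model_check_machine in H. fold D in H. tauto.
Qed.
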